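(* Let $V$ be a finite-dimensional braided vector space of diagonal type over $\mathsf{k}$ whose associated root system is finite (i.e. $\Delta^V_+$ is finite), and let $I(V)$ be the ideal of $T(V)$ such that $\mathfrak{B}(V)=T(V)/I(V)$ is the Nichols algebra of $V$. Then $I(V)$ is finitely generated (as a two-sided ideal of $T(V)$).
   Context: $\mathsf{k}$ is an algebraically closed field of characteristic $0$. A braided vector space $(V,c)$ is of diagonal type if there are a basis $x_1,\dots,x_\theta$ of $V$ and scalars $q_{ij}\in\mathsf{k}^\times$ with $c(x_i\otimes x_j)=q_{ij}\,x_j\otimes x_i$. Let $\alpha_1,\dots,\alpha_\theta$ be the canonical basis of $\mathbb{Z}^\theta$; $T(V)$ is $\mathbb{Z}^\theta$-graded with $\deg x_i=\alpha_i$, and $\chi:\mathbb{Z}^\theta\times\mathbb{Z}^\theta\to\mathsf{k}^\times$ is the bicharacter with $\chi(\alpha_i,\alpha_j)=q_{ij}$. $T(V)$ is a braided Hopf algebra in which the elements of $V$ are primitive, where $T(V)\otimes T(V)$ has the product $(a\otimes b)(a'\otimes b')=\chi(\deg b,\deg a')\,aa'\otimes bb'$ for homogeneous elements. $I(V)$ is the largest $\mathbb{Z}^\theta$-graded two-sided ideal $I\subseteq\bigoplus_{n\ge2}T^n(V)$ with $\Delta(I)\subseteq I\otimes T(V)+T(V)\otimes I$, and $\mathfrak{B}(V)=T(V)/I(V)$. Root system: words in $x_1,\dots,x_\theta$ are ordered lexicographically with $x_1<\dots<x_\theta$ (a proper prefix of a word is smaller than the word). A nonempty word is Lyndon if it is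 smaller than each of its proper nonempty ends (suffixes). Write $u\succ v$ if $\ell(u)<\ell(v)$, or $\ell(u)=\ell(v)$ and $u>v$ lexicographically ($\ell$ = length). Let $S$ be the set of Lyndon words $u$ which do not lie in $\operatorname{span}\{w: w\succ u\}+I(V)$. By Kharchenko's theorem, $S$ labels the generators of a PBW basis of $\mathfrak{B}(V)$. $\Delta^V_+$ is the set of degrees in $\mathbb{N}_0^\theta$ of the generators of a PBW basis of $\mathfrak{B}(V)$, counted with multiplicity (it does not depend on the PBW basis); that is, $\Delta^V_+$ is the family of degrees of the elements of $S$. *)

(* Defs.v *)
From HB Require Import structures.
From mathcomp Require Import all_boot all_order all_algebra.
From mathcomp Require Import finmap.
From mathcomp.multinomials Require Import monalg.

Set Implicit Arguments.
Unset Strict Implicit.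
Unset Printing Implicit Defensive.

Import Order.TTheory GRing.Theory Num.Theory.
Local Open Scope ring_scope.

(* The letter [i : 'I_n] stands for the basis vector x_(i+1), so that a word
   is a noncommutative monomial in x_1, ..., x_n. *)
Definition word (n : nat) : Type := seq 'I_n.

HB.instance Definition _ n := Choice.on (word n).

Lemma word_unitm n (u v : word n) : u ++ v = [::] -> u = [::] /\ v = [::].
Proof. by case: u. Qed.

HB.instance Definition _ n := Choice_isMonomialDef.Build (word n)
  (@catA 'I_n) (@cat0s 'I_n) (@cats0 'I_n) (@word_unitm n).

(* T(V) for V with basis x_1, ..., x_n is the free algebra on x_1, ..., x_n,
   i.e. the algebra of the free monoid of words. *)
Notation talg k n := {malg k[word n]}.

(* T(V) (x) T(V) as a vector space: the pair (u, v) is the basis vector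
   u (x) v. *)
Notation talg2 k n := {malg k[(word n * word n)%type]}.

Section TensorAlgebra.
Variables (k : fieldType) (n : nat).
Implicit Types (q : 'M[k]_n) (u v w : word n) (f g : talg k n).
Implicit Types (s t : talg2 k n) (I J : talg k n -> Prop).

Definition alpha (i : 'I_n) : 'rV[int]_n := delta_mx 0 i.

Definition deg w : 'rV[int]_n := \sum_(i <- w) alpha i.

Definition chi q (a b : 'rV[int]_n) : k :=
  \prod_(i < n) \prod_(j < n) q i j ^ (a 0 i * b 0 j).

Definition mon w : talg k n := << w >>.

Definition tens f g : talg2 k n :=
  \sum_(u <- msupp f) \sum_(v <- msupp g) << f@_u * g@_v *g (u, v) >>.

(* (u (x) v) (u' (x) v') = chi(deg v, deg u') uu' (x) vv' *)
Definition bmul q s t : talg2 k n :=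
  \sum_(x <- msupp s) \sum_(y <- msupp t)
    << s@_x * t@_y * chi q (deg x.2) (deg y.1)
         *g (x.1 ++ y.1, x.2 ++ y.2) >>.

(* The coproduct is the algebra map T(V) -> T(V) (x) T(V), for the braided
   product [bmul], in which every x_i is primitive. *)
Definition comul_letter (i : 'I_n) : talg2 k n :=
  tens (mon [:: i]) 1 + tens 1 (mon [:: i]).

Definition comul_word q w : talg2 k n :=
  foldr (fun i t => bmul q (comul_letter i) t) (tens 1 1) w.

Definition comul q f : talg2 k n :=
  \sum_(w <- msupp f) f@_w *: comul_word q w.

Definition hcomp (a : 'rV[int]_n) f : talg k n :=
  \sum_(w <- msupp f | deg w == a) << f@_w *g w >>.

(* Closure under scalars follows, as [c *: f = c%:MP * f]. *)
Definition two_sided_ideal I :=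
  [/\ I 0, forall f g, I f -> I g -> I (f + g)
    & forall f g, I f -> I (g * f) /\ I (f * g)].

Definition graded I := forall f, I f -> forall a, I (hcomp a f).

(* I is contained in the sum of the T^m(V), m >= 2. *)
Definition in_length_ge2 I :=
  forall f, I f -> forall w, f@_w != 0 -> (2 <= size w)%N.

(* Membership in I (x) T(V) + T(V) (x) I *)
Definition in_tens_ideal I t :=
  exists l : seq (talg k n * talg k n),
    (forall x, x \in l -> I x.1 \/ I x.2)
    /\ t = \sum_(x <- l) tens x.1 x.2.

Definition coideal q I := forall f, I f -> in_tens_ideal I (comul q f).

Definition graded_biideal q I :=
  [/\ two_sided_ideal I, graded I, in_length_ge2 I & coideal q I].

(* I(V); [nichols_ideal_largest] below shows that this union is the largest
   graded biideal. *)
Definition nichols_ideal q f := exists I, graded_biideal q I /\ I f.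

Definition gen_ideal (G : seq (talg k n)) f :=
  exists l : seq (talg k n * talg k n * talg k n),
    (forall x, x \in l -> x.1.2 \in G)
    /\ f = \sum_(x <- l) x.1.1 * x.1.2 * x.2.

Definition finitely_generated_ideal I :=
  exists G : seq (talg k n), forall f, I f <-> gen_ideal G f.

(* [seqlexi] is the lexicographic order on sequences in which a proper prefix
   is smaller. *)
Definition lex_lt u v : bool :=
  ((u : seqlexi 'I_n) < (v : seqlexi 'I_n))%O.

Definition lyndon u :=
  u <> [::] /\
  forall v w, v <> [::] -> w <> [::] -> u = v ++ w -> lex_lt u w.

(* [wsucc u v] is u > v in the length-then-reverse-lexicographic order: the
   shorter word is the larger one. *)
Definition wsucc u v : bool :=
  (size u < size v)%N || (size u == size v) && lex_lt v u.

Definition in_span_succ u f := forall w, f@_w != 0 -> wsucc w u.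

(* The set S of Lyndon words labelling Kharchenko's PBW generators *)
Definition pbw_letter q u :=
  lyndon u /\
  ~ (exists f g, [/\ in_span_succ u f, nichols_ideal q g & mon u = f + g]).

(* The finite multiset D of degrees is Delta^V_+, the family of degrees of the
   elements of S, counted with multiplicity. *)
Definition is_pos_roots q (D : seq 'rV[int]_n) :=
  exists l : seq (word n),
    [/\ uniq l, forall u, u \in l <-> pbw_letter q u
      & perm_eq D [seq deg u | u <- l]].

Definition finite_root_system q := exists D, is_pos_roots q D.

End TensorAlgebra.

Section Largest.
Variables (k : fieldType) (n : nat).
Implicit Types (q : 'M[k]_n) (f g : talg k n) (I J : talg k n -> Prop).

Lemma hcompD a f g : hcomp a (f + g) = hcomp a f + hcomp a g.
Proof.
have E h w : (hcomp a h)@_w = if deg w == a then h@_w else 0.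
  rewrite /hcomp raddf_sum /=.
  under eq_bigr do rewrite mcoeffU.
  have [wh|wh] := boolP (w \in msupp h).
    case: ifP => dw.
      rewrite big_mkcond (big_fsetD1 w) //= dw eqxx mulr1n big1_fset ?addr0 //.
      move=> v; rewrite in_fsetD1 => /andP[/negbTE vw _] _.
      by case: ifP => //; rewrite vw.
    apply: big1 => v dv; case: eqVneq => // vw.
    by rewrite -vw dv in dw.
  rewrite (mcoeff_outdom wh) if_same; apply: big1_fset => v vh _.
  by case: eqVneq => // vw; rewrite -vw vh in wh.
apply/malgP => w; rewrite mcoeffD !E.
by case: ifP; rewrite ?addr0 // mcoeffD.
Qed.

Lemma comulD q f g : comul q (f + g) = comul q f + comul q g.
Proof.
have E (d : {fset word n}) h : (forall w, w \in msupp h -> w \in d) ->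
    comul q h = \sum_(w <- d) h@_w *: comul_word q w.
  move=> /fsubsetP le; apply: big_fset_incl => //= w _ /mcoeff_outdom ->.
  exact: scale0r.
set d := (msupp f `|` msupp g)%fset.
rewrite (E d f); last by move=> w; rewrite /d in_fsetU => ->.
rewrite (E d g); last by move=> w; rewrite /d in_fsetU orbC => ->.
rewrite (E d) -?big_split /=; first by apply: eq_bigr => w _; rewrite mcoeffD scalerDl.
by apply/fsubsetP/msuppD_le.
Qed.

Lemma graded_biideal0 q : graded_biideal q (fun f => f = 0).
Proof.
split=> [|f -> a|f -> w|f ->].
- split=> [//|f g -> ->|f g ->]; first by rewrite addr0.
  by rewrite mulr0 mul0r.
- by rewrite /hcomp msupp0 big_seq_cond big1 // => w; rewrite in_fset0.
- by rewrite mcoeff0 eqxx.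
- by exists [::]; split=> //; rewrite /comul msupp0 big_seq_fset0 big_nil.
Qed.

Lemma graded_biidealD q I J : graded_biideal q I -> graded_biideal q J ->
  graded_biideal q (fun f => exists g h, [/\ I g, J h & f = g + h]).
Proof.
move=> [[I0 ID IM] Ig I2 Ic] [[J0 JD JM] Jg J2 Jc].
split.
- split.
  + by exists 0, 0; rewrite addr0.
  + move=> _ _ [g1 [h1 [Ig1 Jh1 ->]]] [g2 [h2 [Ig2 Jh2 ->]]].
    exists (g1 + g2), (h1 + h2); split; [exact: ID|exact: JD|exact: addrACA].
  + move=> _ f [g [h [Ig1 Jh ->]]].
    have [? ?] := IM _ f Ig1; have [? ?] := JM _ f Jh.
    split; first by exists (f * g), (f * h); rewrite mulrDr.
    by exists (g * f), (h * f); rewrite mulrDl.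
- move=> _ [g [h [Ig1 Jh ->]]] a; exists (hcomp a g), (hcomp a h).
  by split; [exact: Ig|exact: Jg|exact: hcompD].
- move=> _ [g [h [Ig1 Jh ->]]] w; rewrite mcoeffD.
  have [gw|/(I2 _ Ig1)//] := eqVneq (g@_w) 0; rewrite gw add0r.
  exact: J2.
- move=> _ [g [h [Ig1 Jh ->]]].
  have [l1 [Il1 E1]] := Ic _ Ig1; have [l2 [Jl2 E2]] := Jc _ Jh.
  exists (l1 ++ l2); split; last by rewrite comulD E1 E2 big_cat.
  move=> x; rewrite mem_cat => /orP[/Il1|/Jl2] [H|H]; [left|right|left|right].
  + by exists x.1, 0; rewrite addr0.
  + by exists x.2, 0; rewrite addr0.
  + by exists 0, x.1; rewrite add0r.
  + by exists 0, x.2; rewrite add0r.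
Qed.

Lemma nichols_ideal_largest q :
  graded_biideal q (nichols_ideal q) /\
  forall I, graded_biideal q I -> forall f, I f -> nichols_ideal q f.
Proof.
split; last by move=> I HI f If; exists I.
split.
- split.
  + by exists (fun f => f = 0); split=> //; exact: graded_biideal0.
  + move=> f g [I [HI If]] [J [HJ Jg]].
    by eexists; split; [exact: graded_biidealD HI HJ|exists f, g].
  + move=> f g [I [HI If]]; have [[_ _ /(_ _ g If)[? ?]] _ _ _] := HI.
    by split; exists I.
- move=> f [I [HI If]] a; have [_ /(_ _ If a) ? _ _] := HI.
  by exists I.
- by move=> f [I [[_ _ H _] If]]; exact: H.
- move=> f [I [HI If]]; have [_ _ _ /(_ _ If)[l [Il E]]] := HI.
  by exists l; split=> // x /Il[?|?]; [left|right]; exists I.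
Qed.

End Largest.

(* Main.v *)
Require Import Defs.
From HB Require Import structures.
From mathcomp Require Import all_boot all_order all_algebra.
From mathcomp Require Import finmap boolp.
From mathcomp.multinomials Require Import monalg.

(* Noncommutative Groebner bases: I(V) is generated by finitely many elements
   as soon as finitely many words are obstructions, i.e. minimal (for the factor
   order) among the words w lying in span{w' : w' > w} + I(V) for the order of
   Kharchenko. Every nonempty word is either a power v^j of a Lyndon word or a
   product ab in which every nonempty end of a is bigger than b; in the second
   case every shuffle of x <= a and y <= b other than the concatenation ab is
   lexicographically smaller than ab, so that a (x) b occurs with coefficient 1
   in the reduction of the coproduct of an element of I(V) with leading word ab,
   and ab is not an obstruction. A Lyndon word of length at least 2 is a product
   of two Lyndon words. Hence an obstruction is either cv with c, v in S, or the
   first reducible power of some v in S, and S is finite. *)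

Set Implicit Arguments.
Unset Strict Implicit.
Unset Printing Implicit Defensive.

Import Order.TTheory GRing.Theory.
Local Open Scope ring_scope.

(** * Lexicographic and Kharchenko orders on words *)

Section Words.
Variable n : nat.
Implicit Types (x y : 'I_n) (u v w a b c p s t z : word n) (m : bitseq).

Lemma lex_lt0 u : lex_lt u [::] = false.
Proof. by rewrite /lex_lt ltxis0. Qed.

Lemma lex_0lt u : lex_lt [::] u = (u != [::]).
Proof. by case: u => [|x u]; rewrite /lex_lt ?ltxx ?ltxis0. Qed.

Lemma lex_lt_cons x u y v :
  lex_lt (x :: u) (y :: v) = (x < y)%N || (x == y) && lex_lt u v.
Proof.
rewrite /lex_lt ltxi_cons.
have [e|ne] := eqVneq x y; first by rewrite e lexx ltnn.
by rewrite orbF; have := ltn_neqAle x y; rewrite -[(x <= y)%N]/(x <= y)%O -[(x < y)%N]/(x < y)%O; case: ltgtP ne.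
Qed.

Lemma lex_lt_irr u : lex_lt u u = false.
Proof. exact: ltxx. Qed.

Lemma lex_lt_trans v u w : lex_lt u v -> lex_lt v w -> lex_lt u w.
Proof. exact: lt_trans. Qed.

Lemma lex_lt_total u v : [\/ u = v, lex_lt u v | lex_lt v u].
Proof. by rewrite /lex_lt; case: (ltgtP (u : seqlexi _) v) => h; [apply: Or32|apply: Or33|apply: Or31]. Qed.

Lemma lex_ltNgt u v : ~~ lex_lt u v -> u = v \/ lex_lt v u.
Proof. by case: (lex_lt_total u v) => [->|->|]; auto. Qed.

Lemma lex_lt_cat2l p u v : lex_lt (p ++ u) (p ++ v) = lex_lt u v.
Proof. by elim: p => //= x p IH; rewrite lex_lt_cons ltnn eqxx. Qed.

Lemma lex_lt_prefix u s : s != [::] -> lex_lt u (u ++ s).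
Proof. by move=> h; rewrite -{1}[u]cats0 lex_lt_cat2l lex_0lt. Qed.

(** Either [u] is a proper prefix of [v], or the first differing letter decides the comparison, and
    then it survives any continuation of both words. *)
Lemma lex_ltP u v : lex_lt u v ->
  (exists2 s, s != [::] & v = u ++ s) \/
  (forall s t, lex_lt (u ++ s) (v ++ t)).
Proof.
elim: u v => [|x u IH] [|y v]; rewrite ?lex_lt0 //.
  by left; exists (y :: v).
rewrite lex_lt_cons => /orP[lt|/andP[/eqP <- /IH[[s s0 ->]|h]]].
- by right=> s t; rewrite !cat_cons lex_lt_cons lt.
- by left; exists s.
- by right=> s t; rewrite !cat_cons lex_lt_cons eqxx h orbT.
Qed.

Lemma lex_lt_cat2r u v s : size u = size v ->
  lex_lt (u ++ s) (v ++ s) = lex_lt u v.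
Proof.
elim: u v => [|x u IH] [|y v] //=; first by rewrite !lex_lt_irr.
by case=> /IH e; rewrite !lex_lt_cons e.
Qed.

Lemma wsucc_irr u : wsucc u u = false.
Proof. by rewrite /wsucc ltnn lex_lt_irr andbF. Qed.

Lemma wsucc_trans v u w : wsucc u v -> wsucc v w -> wsucc u w.
Proof.
rewrite /wsucc => /orP[uv|/andP[/eqP uv luv]] /orP[vw|/andP[/eqP vw lvw]].
- by rewrite (ltn_trans uv vw).
- by rewrite -vw uv.
- by rewrite uv vw.
- by rewrite uv vw eqxx (lex_lt_trans lvw luv) orbT.
Qed.

Lemma wsucc_total u v : [\/ u = v, wsucc u v | wsucc v u].
Proof.
rewrite /wsucc; have [uv|vu|e] := ltngtP (size u) (size v).
- exact: Or32.
- exact: Or33.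
- by case: (lex_lt_total u v) => [->|->|->]; [apply: Or31|apply: Or33|apply: Or32].
Qed.

Lemma wsucc_cat p s u v : wsucc u v -> wsucc (p ++ u ++ s) (p ++ v ++ s).
Proof.
rewrite /wsucc !size_cat => /orP[lt|/andP[/eqP e lt]].
  by rewrite ltn_add2l ltn_add2r lt.
by rewrite e eqxx lex_lt_cat2l lex_lt_cat2r // lt orbT.
Qed.

(** A word bigger than [u] is no longer than [u], and the alphabet is finite, so only finitely many
    words are bigger. With the length bound [N] kept fixed, [rank] counts them and strictly drops at
    each step up. *)
Lemma wsucc_ind (P : word n -> Prop) :
  (forall u, (forall w, wsucc w u -> P w) -> P u) -> forall u, P u.
Proof.
move=> IH u; have [N uN] := ubnPleq (size u).
pose rank v := #|[set t : N.-bseq 'I_n | wsucc (t : seq _) v]|.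
have [r] := ubnP (rank u); elim: r u uN => // r IHr u uN /ltnSE rur.
apply: IH => w wu.
have wN : (size w <= N)%N.
  by apply: leq_trans uN; case/orP: wu => [/ltnW//|/andP[/eqP->]].
apply: (IHr w wN); apply: leq_trans rur; apply/proper_card/properP; split.
  by apply/subsetP=> t; rewrite !inE => /wsucc_trans; apply.
exists (Bseq wN); rewrite ?inE //=.
by rewrite wsucc_irr.
Qed.

(** * Shuffles of two words, encoded by masks *)

(* A mask that picks a word out of a shuffle is mixed when the shuffle is not
   the plain concatenation of the two shuffled words. *)
Definition mixed m := subseq [:: false; true] m.

Lemma mask_has_true m z : size m = size z -> (true \in m) = (mask m z != [::]).
Proof.
move=> e; rewrite -size_eq0 size_mask // -lt0n -has_count -has_pred1.
by apply: eq_has => -[].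
Qed.

Lemma unmixedE m : ~~ mixed m ->
  m = nseq (count id m) true ++ nseq (count negb m) false.
Proof.
elim: m => [//|[] m IH] h /=; first by rewrite -IH.
have tm : true \notin m by move: h; rewrite /mixed /= sub1seq.
have -> : count id m = 0%N.
  by apply/eqP; rewrite -leqn0 leqNgt -has_count; apply: contra tm => /hasP[[]].
rewrite /=; congr (_ :: _); elim: m tm {h IH} => [//|[] m IH] //=.
by rewrite in_cons /= => /IH <-.
Qed.

Lemma mask_nseq_cat a b :
  let m := nseq (size a) true ++ nseq (size b) false in
  [/\ size m = size (a ++ b), mask m (a ++ b) = a
    & mask (map negb m) (a ++ b) = b].
Proof.
move=> m; rewrite /m !size_cat !size_nseq map_cat !map_nseq; split=> //.
  by rewrite mask_cat ?size_nseq // mask_true // mask_false cats0.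
by rewrite mask_cat ?size_nseq // mask_false mask_true.
Qed.

Lemma unmixed_cat m z : size m = size z -> ~~ mixed m ->
  z = mask m z ++ mask (map negb m) z.
Proof.
elim: z m => [|x z IH] [|[] m] //= [e] h; first by rewrite -IH.
have tm : true \notin m by move: h; rewrite /mixed /= sub1seq.
have : mask m z = [::] by apply/eqP; move: tm; rewrite (mask_has_true e) negbK.
move=> E; rewrite E /=; congr (_ :: _); rewrite [LHS](IH m) ?E //.
by apply: contra tm => /mem_subseq -> //; rewrite !inE.
Qed.

(* The step behind the optimality of greedy merging: a shuffle that has already
   taken p from p t is no bigger than one that has taken it from p s. *)
Lemma shuffle_exchange z m p s t : size m = size z -> p != [::] ->
  lex_lt t s -> mask m z = p ++ s -> mask (map negb m) z = t ->
  exists m' z', [/\ size m' = size z', mask m' z' = s,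
    mask (map negb m') z' = p ++ t & lex_lt z z' \/ z = z' /\ mixed m'].
Proof.
elim: z m p s t => [|x z IH] m p s t sz p0 lt.
  by rewrite mask0; case: p p0.
have s0 : s != [::] by apply: contraTneq lt => ->; rewrite lex_lt0.
case: m sz => [//|[] m] [sz] /= E1 E2.
  case: p p0 E1 => [//|y p] _ [-> E1].
  have [p0|p0] := eqVneq p [::].
    (* Here [p] was the single letter [y]: relabelling it as taken from the other word leaves the
       shuffle itself unchanged, and the mask is mixed because [s] is nonempty. *)
    exists (false :: m), (y :: z); split=> /=; rewrite ?sz ?p0 ?E2 ?E1 ?p0 //.
    by right; rewrite /mixed /= sub1seq (mask_has_true sz) E1 p0.
  have [m' [z' [e1 e2 e3 e4]]] := IH m p s t sz p0 lt E1 E2.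
  exists (false :: m'), (y :: z'); split; rewrite /= ?e1 ?e2 ?e3 //.
  rewrite lex_lt_cons eqxx ltnn; case: e4 => [->|[-> _]]; [by left|right].
  by rewrite /mixed /= sub1seq (mask_has_true e1) e2.
case: t lt E2 => [//|x' t] lt [xx' E2]; subst x'.
case: s s0 lt E1 => [//|y s] s0; rewrite lex_lt_cons => /orP[lt|/andP[/eqP<- lt]] E1.
  have [e1 e2 e3] := mask_nseq_cat (y :: s) (p ++ x :: t).
  eexists; exists ((y :: s) ++ p ++ x :: t); split; [exact: e1|exact: e2|exact: e3|].
  by left; rewrite lex_lt_cons lt.
(* Both remaining words start with the letter [x]; the one from [s] joins the common prefix, and the
   induction goes on with the shorter tails. *)
have [] := IH m (rcons p x) s t sz _ lt _ E2; [by case: p {E1 p0}|by rewrite cat_rcons|].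
move=> m' [z' [e1 e2 e3 e4]]; exists (true :: m'), (x :: z').
split; rewrite /= ?e1 ?e2 ?e3 ?cat_rcons // lex_lt_cons ltnn eqxx.
by case: e4 => [->|[-> ?]]; [left|right].
Qed.

Definition suffixes_gt a b :=
  forall p s, s != [::] -> a = p ++ s -> lex_lt b s.

(** Induction on [a]. A first letter taken from [a] is stripped. A first letter taken from [b] is
    either smaller than that of [a], or equal to it; then [shuffle_exchange] turns the rest into a
    shuffle of the tail of [a] with all of [b] that is no smaller, and is strictly bigger if it is
    the plain concatenation. *)
Lemma shuffle_lt a b z m : suffixes_gt a b -> size m = size z ->
  mask m z = a -> mask (map negb m) z = b -> mixed m -> lex_lt z (a ++ b).
Proof.
elim: a z m => [|y a IH] z m ab sz E1 E2 mm.
  suff: true \in m; first by rewrite (mask_has_true sz) E1.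
  by apply: mem_subseq mm _ _; rewrite !inE.
have ab' : suffixes_gt a b by move=> p s s0 e; apply: (ab (y :: p) s) => //=; rewrite e.
case: z m sz E1 E2 mm => [|x z] [|[] m] //= [sz].
  by move=> [-> E1] E2 mm; rewrite lex_lt_cons eqxx (IH z m) ?orbT.
move=> E1; have := ab [::] (y :: a) isT erefl.
case: b ab ab' IH => [//|x' b] ab ab' IH lt [xx' E2] _; subst x'.
move: lt; rewrite !lex_lt_cons => /orP[->//|/andP[/eqP xy lt]]; subst y.
have [m' [z' [e1 e2 e3 e4]]] := shuffle_exchange sz (isT : [:: x] != [::]) lt
  (etrans E1 (erefl : _ = [:: x] ++ a)) E2.
rewrite ltnn eqxx /=; case: (boolP (mixed m')) => mm'.
  have lt' := IH z' m' ab' e1 e2 e3 mm'.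
  by case: e4 => [/lex_lt_trans->|[->]].
case: e4 => [|[_ /negP//]]; first by rewrite [z'](unmixed_cat e1 mm') e2 e3.
by rewrite (negbTE mm').
Qed.

Lemma unmask m a b : count id m = size a -> count negb m = size b ->
  exists z, [/\ size m = size z, mask m z = a & mask (map negb m) z = b].
Proof.
elim: m a b => [|[] m IH] a b /=.
- by case: a b => [|//] [|//]; exists [::].
- case: a => [|x a] //= [ea] eb; have [z [e1 e2 e3]] := IH a b ea eb.
  by exists (x :: z); rewrite /= e1 e2 e3.
- case: b => [|x b] //= ea [eb]; have [z [e1 e2 e3]] := IH a b ea eb.
  by exists (x :: z); rewrite /= e1 e2 e3.
Qed.

(** The mask stays fixed while the two words are raised. The first letter that strictly grows
    decides the comparison, so the later positions may be filled by [unmask]. *)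
Lemma shuffle_mono m a b z : size m = size z ->
  size (mask m z) = size a -> size (mask (map negb m) z) = size b ->
  ~~ lex_lt a (mask m z) -> ~~ lex_lt b (mask (map negb m) z) ->
  exists z', [/\ size m = size z', mask m z' = a, mask (map negb m) z' = b
    & z = z' \/ lex_lt z z'].
Proof.
elim: m a b z => [|i m IH] a b [|x z] //=.
  by case: a b => [|//] [|//] *; exists [::]; split=> //; left.
case: i => /= -[sz].
- case: a => [//|y a] [sa] sb /lex_ltNgt lta ltb.
  have [lt|[xy lta']] : (x < y)%N \/ x = y /\ ~~ lex_lt a (mask m z).
    case: lta => [[-> ->]|]; first by right; rewrite lex_lt_irr.
    rewrite lex_lt_cons => /orP[|/andP[/eqP<- lt]]; [by left|right; split=> //].
    by apply/negP => /(lex_lt_trans lt); rewrite lex_lt_irr.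
  + have [||z' [e1 e2 e3]] := @unmask m a b.
    * by rewrite -sa size_mask.
    * rewrite -sb size_mask ?size_map // count_map; exact: eq_count.
    exists (y :: z'); rewrite /= e1 e2 e3; split=> //; right.
    by rewrite lex_lt_cons lt.
  + have [z' [e1 e2 e3 e4]] := IH a b z sz sa sb lta' ltb.
    exists (x :: z'); rewrite /= e1 e2 e3 xy; split=> //.
    by case: e4 => [->|lt]; [left|right; rewrite lex_lt_cons eqxx lt orbT].
- case: b => [//|y b] sa [sb] lta /lex_ltNgt ltb.
  have [lt|[xy ltb']] : (x < y)%N \/ x = y /\ ~~ lex_lt b (mask (map negb m) z).
    case: ltb => [[-> ->]|]; first by right; rewrite lex_lt_irr.
    rewrite lex_lt_cons => /orP[|/andP[/eqP<- lt]]; [by left|right; split=> //].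
    by apply/negP => /(lex_lt_trans lt); rewrite lex_lt_irr.
  + have [||z' [e1 e2 e3]] := @unmask m a b.
    * by rewrite -sa size_mask.
    * rewrite -sb size_mask ?size_map // count_map; exact: eq_count.
    exists (y :: z'); rewrite /= e1 e2 e3; split=> //; right.
    by rewrite lex_lt_cons lt.
  + have [z' [e1 e2 e3 e4]] := IH a b z sz sa sb lta ltb'.
    exists (x :: z'); rewrite /= e1 e2 e3 xy; split=> //.
    by case: e4 => [->|lt]; [left|right; rewrite lex_lt_cons eqxx lt orbT].
Qed.

(** Raise the two parts to [a] and [b] by [shuffle_mono], then compare with the concatenation by
    [shuffle_lt]; equality leaves only the unmixed mask. *)
Lemma shuffle_max a b z m : suffixes_gt a b -> size m = size z ->
  size (mask m z) = size a -> size (mask (map negb m) z) = size b ->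
  ~~ lex_lt a (mask m z) -> ~~ lex_lt b (mask (map negb m) z) ->
  lex_lt z (a ++ b) \/
  z = a ++ b /\ m = nseq (size a) true ++ nseq (size b) false.
Proof.
move=> ab sz sa sb lta ltb.
have [z' [e1 e2 e3 e4]] := shuffle_mono sz sa sb lta ltb.
have [mm|mm] := boolP (mixed m).
  have lt := shuffle_lt ab e1 e2 e3 mm; left.
  by case: e4 => [->|/lex_lt_trans->].
have Ez' : z' = a ++ b by rewrite [LHS](unmixed_cat e1 mm) e2 e3.
rewrite -Ez'; case: e4 => [->|]; [right; split=> //|by left].
rewrite [LHS](unmixedE mm) -sa -sb !size_mask ?size_map // count_map.
by congr (_ ++ nseq _ _); apply: eq_count.
Qed.

(** * Lyndon words, their powers and factorizations *)

Definition wpow v j : word n := flatten (nseq j v).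

Lemma min_suffix w : w != [::] -> exists c v, [/\ v != [::], w = c ++ v
  & forall p s, s != [::] -> w = p ++ s -> s = v \/ lex_lt v s].
Proof.
elim: w => [//|x w IH] _; have [w0|/IH[c [v [v0 e h]]]] := eqVneq w [::].
  exists [::], [:: x]; split=> //; first by rewrite w0.
  move=> [|y p] s s0; first by rewrite w0 => /= <-; left.
  by rewrite w0 => -[_ /esym/(@word_unitm n)[_ /eqP]]; rewrite (negbTE s0).
have [lt|le] := boolP (lex_lt (x :: w) v).
  exists [::], (x :: w); split=> // -[|y p] s s0; first by move=> /= ->; left.
  case=> _ /h[]// => [->|]; first by right.
  by move=> lt'; right; apply: lex_lt_trans lt'.
exists (x :: c), v; split=> //=; first by rewrite e.
move=> [|y p] s s0; last by case=> _ /h; apply.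
by move=> /= <-; case: (lex_ltNgt le); auto.
Qed.

Lemma min_suffix_lyndon c v : v != [::] ->
  (forall p s, s != [::] -> c ++ v = p ++ s -> s = v \/ lex_lt v s) ->
  lyndon v.
Proof.
move=> /eqP v0 h; split=> // p s p0 /eqP s0 e.
have [|E|//] := h (c ++ p) s s0; first by rewrite e catA.
move: e; rewrite E => /(congr1 size)/eqP.
by rewrite size_cat -{1}[size v]add0n eqn_add2r eq_sym size_eq0 => /eqP.
Qed.

(* A nonempty suffix of c is at least v, since otherwise either it followed by
   v, or what it leaves of v, would be a smaller suffix of c v. *)
Lemma min_suffix_left c v :
  (forall p s, s != [::] -> c ++ v = p ++ s -> s = v \/ lex_lt v s) ->
  forall p s, s != [::] -> c = p ++ s -> s = v \/ lex_lt v s.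
Proof.
move=> h p s s0 E; case: (lex_lt_total s v) => [sv|/lex_ltP[[t t0 e]|lt]|vs]; [by left| | |by right].
  have := h p (s ++ v); rewrite E catA -size_eq0 size_cat addn_eq0 size_eq0.
  rewrite (negbTE s0) => /(_ isT erefl)[].
    move=> /(congr1 size)/eqP; rewrite size_cat -{2}[size v]add0n eqn_add2r.
    by rewrite size_eq0 (negbTE s0).
  rewrite {1}e lex_lt_cat2l => lt.
  have [] := h (c ++ s) t t0; first by rewrite -catA -e.
    move=> tv; move: e; rewrite tv => /(congr1 size)/eqP.
    rewrite size_cat -{1}[size v]add0n eqn_add2r eq_sym size_eq0.
    by rewrite (negbTE s0).
  by move=> /lex_lt_trans/(_ lt); rewrite lex_lt_irr.
have := h p (s ++ v); rewrite E catA -size_eq0 size_cat addn_eq0 size_eq0.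
rewrite (negbTE s0) => /(_ isT erefl)[].
  by move=> E'; have := lt v [::]; rewrite E' cats0 lex_lt_irr.
by move=> /lex_lt_trans/(_ (lt v [::])); rewrite cats0 lex_lt_irr.
Qed.

(** Take for [v] the smallest proper nonempty end of [u]. A proper nonempty end [s] of [c] then
    satisfies c < u < v <= s, so [c] is Lyndon too. *)
Lemma lyndon_split u : lyndon u -> (1 < size u)%N ->
  exists c v, [/\ lyndon c, lyndon v & u = c ++ v].
Proof.
case: u => [//|x u] [_ L] su.
have /min_suffix[c [v [v0 e h]]] : u != [::] by case: u su {L}.
have Lv : lyndon v by apply: (@min_suffix_lyndon c); rewrite -?e.
exists (x :: c), v; rewrite e; split=> //; split=> // p s p0 s0 E.
apply: (@lex_lt_trans ((x :: c) ++ v)); first exact: lex_lt_prefix.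
case: p p0 E => [//|y p] _ [_ E].
have vs : s = v \/ lex_lt v s.
  by apply: (@min_suffix_left c v _ p s) => //; rewrite -?e //; apply/eqP.
have uv : lex_lt (x :: u) v by apply: (L (x :: c)); rewrite ?e //; apply/eqP.
by rewrite cat_cons -e; case: vs => [->|/(lex_lt_trans uv)].
Qed.

(** If an end of [d] starts with [v], what follows is again an end of [d], to be compared with one
    power less; otherwise the comparison with [v] is settled at a letter. *)
Lemma wpow_lt v j d : (forall p s, s != [::] -> d = p ++ s -> lex_lt v s) ->
  suffixes_gt d (wpow v j).
Proof.
move=> h; elim: j => [|j IH] p s s0 e; first by rewrite lex_0lt.
case/lex_ltP: (h p s s0 e) => [[t t0 E]|lt].
  by rewrite E lex_lt_cat2l; apply: (IH (p ++ v)); rewrite // -catA -E.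
by rewrite -[s]cats0; apply: lt.
Qed.

(** An end of [c] can equal [v] only if [c] ends in [v]; such copies are moved into the power one by
    one until none is left. *)
Lemma strip_wpow v c i : v != [::] ->
  (forall p s, s != [::] -> c = p ++ s -> s = v \/ lex_lt v s) ->
  (exists j, c ++ wpow v i = wpow v j) \/
  exists d j, [/\ d != [::], c ++ wpow v i = d ++ wpow v j
    & (i <= j)%N /\ forall p s, s != [::] -> d = p ++ s -> lex_lt v s].
Proof.
move=> v0; have [N] := ubnP (size c); elim: N c i => // N IH c i cN h.
have [c0|c0] := eqVneq c [::]; first by left; exists i; rewrite c0.
have [[p e]|nv] := pselect (exists p, c = p ++ v).
  have pN : (size p < N)%N.
    move: cN; rewrite e size_cat ltnS; apply: leq_trans.
    by rewrite -addn1 leq_add2l lt0n size_eq0.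
  have [|[j E]|[d [j [d0 E [ij hd]]]]] := IH p i.+1 pN.
  - by apply: min_suffix_left => p' s s0 E; apply: h s0 _; rewrite e E.
  - by left; exists j; rewrite -E e -catA.
  - right; exists d, j; split=> //; first by rewrite -E e -catA.
    by split=> //; apply: ltnW.
right; exists c, i; split=> //; split=> // p s s0 e.
by case: (h p s s0 e) => // sv; case: nv; exists p; rewrite -sv.
Qed.

Lemma lyndon_pow_or_split w : w != [::] ->
  (exists v j, lyndon v /\ w = wpow v j.+1) \/
  (exists a b, [/\ a != [::], b != [::], w = a ++ b & suffixes_gt a b]).
Proof.
move=> w0; have [c [v [v0 E h]]] := min_suffix w0.
rewrite E in h; have Lv := min_suffix_lyndon v0 h.
(* The exponent starts at 1, for the smallest end [v] itself; since it never decreases, the right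
   factor [wpow v j.+1] is nonempty. *)
have := strip_wpow 1 v0 (min_suffix_left h); rewrite /wpow /= cats0 -E.
move=> [[[|j] e]|[d [[|j] [d0 e [] // _ hd]]]].
- by rewrite e in w0.
- by left; exists v, j.
right; exists d, (wpow v j.+1); split=> //; last exact: wpow_lt.
by rewrite /wpow /=; case: (v) v0.
Qed.
End Words.

(** * Linear extension of maps given on a basis *)

Section Lift.
Variables (k : fieldType) (K : choiceType) (V : lmodType k) (phi : K -> V).

Definition lift (f : {malg k[K]}) : V := \sum_(x <- msupp f) f@_x *: phi x.

Lemma liftEw (d : {fset K}) f : {subset msupp f <= d} ->
  lift f = \sum_(x <- d) f@_x *: phi x.
Proof.
move=> /fsubsetP le; apply: big_fset_incl => //= x _ /mcoeff_outdom ->.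
exact: scale0r.
Qed.

Lemma lift_is_linear : linear lift.
Proof.
move=> c f g; set d := (msupp f `|` msupp g)%fset.
have sf : {subset msupp f <= d} by move=> x xf; rewrite in_fsetU xf.
have sg : {subset msupp g <= d} by move=> x xg; rewrite in_fsetU xg orbT.
rewrite (liftEw sf) (liftEw sg) (@liftEw d).
  rewrite scaler_sumr -big_split; apply: eq_bigr => x _ /=.
  by rewrite mcoeffD mcoeffZ scalerDl scalerA.
move=> x xfg; apply: contraLR xfg; rewrite in_fsetU negb_or -!mcoeff_eq0.
by case/andP=> /eqP f0 /eqP g0; rewrite mcoeffD mcoeffZ f0 g0 mulr0 addr0.
Qed.

HB.instance Definition _ :=
  GRing.isLinear.Build k {malg k[K]} V *:%R lift lift_is_linear.

Lemma liftU c x : lift << c *g x >> = c *: phi x.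
Proof.
rewrite (@liftEw [fset x]%fset) ?big_seq_fset1 ?mcoeffUU //.
exact/fsubsetP/msuppU_le.
Qed.

End Lift.

Lemma lift_eq0 (k : fieldType) (K : choiceType) (V : lmodType k)
    (phi : K -> V) (f : {malg k[K]}) :
  (forall x, f@_x != 0 -> phi x = 0) -> lift phi f = 0.
Proof.
move=> phi0; rewrite /lift big_seq big1 // => x.
by rewrite -mcoeff_neq0 => /phi0 ->; rewrite scaler0.
Qed.

Lemma lift_linear (k : fieldType) (K : choiceType) (U V : lmodType k)
    (phi : K -> U) (F : {linear U -> V}) (f : {malg k[K]}) :
  F (lift phi f) = lift (F \o phi) f.
Proof. by rewrite linear_sum; apply: eq_bigr => x _; rewrite linearZ. Qed.

Lemma malgUE (k : fieldType) (K : choiceType) (c : k) (x : K) :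
  << c *g x >> = c *: << x >> :> {malg k[K]}.
Proof. by apply/malgP => y; rewrite mcoeffZ !mcoeffU mulr_natr. Qed.

Lemma lift_id (k : fieldType) (K : choiceType) (f : {malg k[K]}) :
  lift (fun x => << x >>) f = f.
Proof.
by rewrite {2}[f]monalgE; apply: eq_bigr => x _; rewrite [RHS]malgUE.
Qed.

Lemma sub_lift (k : fieldType) (K : choiceType)
    (phi : K -> {malg k[K]}) (f : {malg k[K]}) :
  f - lift phi f = lift (fun x => << x >> - phi x) f.
Proof.
rewrite -{1}[f]lift_id /lift -sumrB.
by apply: eq_bigr => x _; rewrite scalerBr.
Qed.

Lemma lift_supp (k : fieldType) (K L : choiceType)
    (phi : K -> {malg k[L]}) (f : {malg k[K]}) y : (lift phi f)@_y != 0 ->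
  exists2 x, f@_x != 0 & (phi x)@_y != 0.
Proof.
move=> h; apply: contrapT => nex; case/negP: h; apply/eqP.
rewrite raddf_sum /= big_seq big1 // => x; rewrite -mcoeff_neq0 => fx.
rewrite mcoeffZ; have [->|ne] := eqVneq (phi x)@_y 0; first by rewrite mulr0.
by case: nex; exists x.
Qed.

(** * The coproduct of a word as a sum over masks *)

Section Nichols.
Variables (k : fieldType) (n : nat) (q : 'M[k]_n).
Implicit Types (u v w a b : word n) (m : bitseq) (f g r : talg k n).
Implicit Types (J : talg k n -> Prop) (t : talg2 k n).

Lemma monM u v : mon k u * mon k v = mon k (u ++ v).
Proof. by rewrite malgM_def /mon fgmulUU mulr1. Qed.

Lemma mon_coef u v : (mon k u)@_v = (u == v)%:R.
Proof. exact: mcoeffU1. Qed.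

Lemma tensE f g :
  tens f g = lift (fun u => lift (fun v => << (u, v) >> : talg2 k n) g) f.
Proof.
rewrite /tens /lift; apply: eq_bigr => u _; rewrite scaler_sumr.
by apply: eq_bigr => v _; rewrite malgUE scalerA.
Qed.

Lemma bmulE t t' : bmul q t' t = lift (fun x => lift (fun y =>
  << chi q (deg x.2) (deg y.1) *g (x.1 ++ y.1, x.2 ++ y.2) >> : talg2 k n) t) t'.
Proof.
rewrite /bmul /lift; apply: eq_bigr => u _; rewrite scaler_sumr.
by apply: eq_bigr => v _; rewrite [LHS]malgUE [in RHS]malgUE !scalerA.
Qed.

Lemma deg0 : deg ([::] : word n) = 0.
Proof. by rewrite /deg big_nil. Qed.

Lemma chi0l d : chi q 0 d = 1.
Proof. by apply: big1 => i _; apply: big1 => j _; rewrite mxE mul0r. Qed.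

Lemma chi0r d : chi q d 0 = 1.
Proof. by apply: big1 => i _; apply: big1 => j _; rewrite mxE mulr0. Qed.

Fixpoint masks N : seq bitseq :=
  if N is N'.+1 then map (cons true) (masks N') ++ map (cons false) (masks N')
  else [:: [::]].

Lemma mem_masks N m : (m \in masks N) = (size m == N).
Proof.
have inj (b : bool) : injective (cons b : bitseq -> bitseq) by move=> x y [].
elim: N m => [|N IH] [|b m] //=; first by rewrite mem_cat; apply/orP => -[] /mapP[].
rewrite mem_cat; have h (c : bool) : (b :: m \in map (cons c) (masks N)) = (b == c) && (m \in masks N).
  have [->|ne] := eqVneq b c; first by rewrite mem_map.
  by apply/mapP => -[m' _ [e _]]; rewrite e eqxx in ne.
by rewrite !h !IH eqSS; case: b {h}; rewrite ?orbF.
Qed.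

Lemma uniq_masks N : uniq (masks N).
Proof.
have inj (b : bool) : injective (cons b : bitseq -> bitseq) by move=> x y [].
elim: N => //= N IH; rewrite cat_uniq !map_inj_uniq // IH andbT /=.
by apply/hasPn => _ /mapP[m _ ->]; apply/mapP => -[].
Qed.

(* The braiding factor of the term of the coproduct of w whose left component
   is picked by m: each letter sent to the right crosses the later letters sent
   to the left. *)
Fixpoint braid_coef m w : k :=
  match m, w with
  | b :: m', i :: w' =>
    (if b then 1 else chi q (alpha i) (deg (mask m' w'))) * braid_coef m' w'
  | _, _ => 1
  end.

(** The first letter goes left, crossing only the empty word, or goes right, crossing the left
    component made of later letters; the two summands of [comul_letter] give the two kinds of
    masks. *)
Lemma comul_wordE w : comul_word q w = \sum_(m <- masks (size w))
  << braid_coef m w *g (mask m w, mask (map negb m) w) >>.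
Proof.
have one : 1 = mon k ([::] : word n) by [].
have tm u v : tens (mon k u) (mon k v) = << (u, v) >> by rewrite tensE !liftU !scale1r.
have bm z N (c : bitseq -> k) (h : bitseq -> word n * word n) :
    bmul q << z >> (\sum_(m <- masks N) << c m *g h m >>) =
    \sum_(m <- masks N) << c m * chi q (deg z.2) (deg (h m).1)
      *g (z.1 ++ (h m).1, z.2 ++ (h m).2) >>.
  rewrite bmulE liftU scale1r linear_sum; apply: eq_bigr => m _.
  by rewrite /= liftU malgUE scalerA -malgUE.
have bmDl x y t : bmul q (x + y) t = bmul q x t + bmul q y t.
  by rewrite !bmulE linearD.
elim: w => [|i w IH] /=; first by rewrite big_seq1 one tm.
have -> : comul_letter k i = << ([:: i], [::]) >> + << ([::], [:: i]) >>.
  by rewrite /comul_letter one; congr (_ + _); apply: tm.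
rewrite IH bmDl big_cat !big_map; congr (_ + _); rewrite bm; apply: eq_bigr => m _ /=.
  by rewrite deg0 chi0l mulr1 mul1r.
by rewrite {1}/deg big_seq1 mulrC.
Qed.

Lemma braid_coef_unmixed a b :
  braid_coef (nseq (size a) true ++ nseq (size b) false) (a ++ b) = 1.
Proof.
elim: a => [|i a IH] /=; last by rewrite IH mulr1.
by elim: b => //= i b ->; rewrite mask_false deg0 chi0r mulr1.
Qed.

(** * Reducible words and normal forms *)

Definition subspace J :=
  [/\ J 0, forall f g, J f -> J g -> J (f + g) & forall (c : k) f, J f -> J (c *: f)].

Lemma ideal_subspace J : two_sided_ideal J -> subspace J.
Proof.
case=> J0 JD JM; split=> // c f Jf.
by rewrite -mul_malgC; case: (JM f c%:MP Jf).
Qed.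

Lemma subspace_lift J (K : choiceType) (phi : K -> talg k n) (h : {malg k[K]}) :
  subspace J -> (forall x, h@_x != 0 -> J (phi x)) -> J (lift phi h).
Proof.
move=> [J0 JD JZ] H; rewrite /lift big_seq; apply: (big_ind J) => // x.
by rewrite -mcoeff_neq0 => /H; apply: JZ.
Qed.

(** In Groebner terms, [u] is the leading (smallest for [wsucc]) word of an element of [J]. For
    [nichols_ideal q], the Lyndon words that are not reducible are the elements of S. *)
Definition reducible J u :=
  exists f g, [/\ in_span_succ u f, J g & mon k u = f + g].

Definition supported_irr J r := forall u, r@_u != 0 -> ~ reducible J u.

(** A reducible word is replaced by bigger words, which have normal forms by induction. Plain
    reduction is the case [J' = J]; the second space lets the ideal generated by chosen elements of
    [J] do the reducing. *)
Lemma reduction J J' : subspace J' ->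
  (forall u, reducible J u -> reducible J' u) ->
  forall w, exists r, [/\ supported_irr J r,
    forall u, r@_u != 0 -> u = w \/ wsucc u w & J' (mon k w - r)].
Proof.
move=> sJ H; apply: wsucc_ind => w IH.
have [[f [g [sf Jg e]]]|irr] := pselect (reducible J' w); last first.
  have s u : (mon k w)@_u != 0 -> u = w.
    by rewrite mon_coef; have [->|_] := eqVneq w u; rewrite ?eqxx.
  exists (mon k w); split.
  - by move=> u /s -> /H.
  - by move=> u /s; left.
  - by rewrite subrr; case: sJ.
(* [choice] wants a total function; words not bigger than [w] get the dummy value 0. *)
have /choice[R HR] u : exists r, wsucc u w -> [/\ supported_irr J r,
    forall v, r@_v != 0 -> v = u \/ wsucc v u & J' (mon k u - r)].
  have [/IH[r Hr]|nu] := pselect (wsucc u w); first by exists r.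
  by exists 0.
exists (lift R f); split.
- by move=> u /lift_supp[x /sf/HR[h _ _]]; apply: h.
- move=> u /lift_supp[x /sf xw]; have [_ h _ /h hu] := HR x xw.
  by right; case: hu => [->//|/wsucc_trans->].
- rewrite e addrAC; case: (sJ) => _ JD _; apply: JD => //.
  rewrite sub_lift.
  by apply: subspace_lift => // x /sf xw; case: (HR x xw).
Qed.

Lemma leading_word f : f != 0 ->
  exists2 u, f@_u != 0 & forall w, f@_w != 0 -> w = u \/ wsucc w u.
Proof.
move=> f0; have : (msupp f : seq _) != [::].
  apply: contra f0 => /eqP e; rewrite -msupp_eq0; apply/eqP/fsetP => w.
  by rewrite in_fset0 -[w \in msupp f]/(w \in (msupp f : seq _)) e.
have : (msupp f : seq _) != [::] ->
    exists2 u, u \in (msupp f : seq _) & forall w, w \in (msupp f : seq _) -> w = u \/ wsucc w u.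
  elim: (msupp f : seq _) => [//|x s IH] _.
  have [->|/IH[u us um]] := eqVneq s [::].
    by exists x => [|w]; rewrite inE // => /eqP; left.
  case: (wsucc_total x u) => xu.
  - exists u => [|w]; rewrite inE ?us ?orbT // => /orP[/eqP->|/um//]; by left.
  - exists u => [|w]; rewrite inE ?us ?orbT // => /orP[/eqP->|/um//]; by right.
  - exists x => [|w]; rewrite inE ?eqxx // => /orP[/eqP->|/um ws]; first by left.
    by right; case: ws => [->//|/wsucc_trans->].
by move=> /[apply]-[u us um]; exists u => [|w]; rewrite mcoeff_neq0 // => /um.
Qed.

(** A nonzero element of [J], divided by its leading coefficient, would make its own leading word
    reducible. *)
Lemma supported_irr0 J f : subspace J -> J f -> supported_irr J f -> f = 0.
Proof.
move=> [_ _ JZ] Jf irr; apply/eqP; apply: contrapT => /negP f0.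
have [u fu um] := leading_word f0; case: (irr u fu).
exists (mon k u - (f@_u)^-1 *: f), ((f@_u)^-1 *: f); split; rewrite ?subrK //.
  move=> w; rewrite mcoeffB mcoeffZ mon_coef.
  have [wu|/eqP wu] := eqVneq u w; first by rewrite -wu mulVf // subrr eqxx.
  rewrite sub0r oppr_eq0 mulf_eq0 negb_or => /andP[_ /um[e|//]].
  by case: wu.
exact: JZ.
Qed.

(** [phi a x] is the coefficient of [a] in the normal form of [x]. The normal form of an element of
    [J] lies in [J] and is therefore 0, an irreducible word is its own normal form, and normal forms
    only involve the word itself and bigger ones. *)
Lemma irr_separating J : subspace J -> exists phi : word n -> word n -> k,
  [/\ forall a g, J g -> lift (phi a : word n -> k^o) g = 0,
      forall a x, wsucc x a -> phi a x = 0
    & forall a, ~ reducible J a -> phi a a = 1].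
Proof.
move=> sJ; have [J0 JD JZ] := sJ.
have /choice[R HR] := reduction sJ (fun u => id).
exists (fun a x => (R x)@_a); split.
- move=> a g Jg.
  have h : J (lift R g).
    rewrite -[lift R g](subKr g) sub_lift -scaleN1r; apply: (JD) => //; apply: (JZ).
    by apply: subspace_lift => // x _; case: (HR x).
  have h0 : lift R g = 0.
    apply: supported_irr0 h _ => // u /lift_supp[x _].
    by have [h' _ _ /h'] := HR x.
  transitivity ((lift R g)@_a); last by rewrite h0 mcoeff0.
  by rewrite raddf_sum /=; apply: eq_bigr => u _; rewrite mcoeffZ.
- move=> a x xa; apply/eqP; apply: contrapT => /negP Ra.
  have [_ h _] := HR x; case: (h _ Ra) => [e|ax].
    by rewrite e wsucc_irr in xa.
  by have := wsucc_trans xa ax; rewrite wsucc_irr.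
- move=> a na; have [irr _ Ja] := HR a.
  have <- : mon k a = R a.
    apply/eqP; rewrite -subr_eq0; apply/eqP; apply: supported_irr0 Ja _ => // u.
    rewrite mcoeffB mon_coef; have [<-//|_] := eqVneq a u.
    by rewrite sub0r oppr_eq0 => /irr.
  by rewrite mon_coef eqxx.
Qed.

(** * Functionals on the coproduct, and products of irreducible words *)

Section CoproductFunctional.
Variables (phi psi : word n -> k).

Definition tens_functional (h : word n * word n) : k^o := phi h.1 * psi h.2.

Lemma tens_functionalE f g : lift tens_functional (tens f g) =
  lift (phi : word n -> k^o) f * lift (psi : word n -> k^o) g.
Proof.
rewrite tensE (lift_linear _ (lift tens_functional)) [in RHS]/lift mulr_suml.
apply: eq_bigr => u _ /=; rewrite -scalerAl; congr (_ *: _).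
rewrite (lift_linear _ (lift tens_functional)) mulr_sumr.
by apply: eq_bigr => v _ /=; rewrite liftU scale1r -scalerAr.
Qed.

(** In a term that is not killed the components are at least as long as [a] and [b]. As [u] is no
    longer than [a ++ b], the lengths agree, and [shuffle_max] leaves only [u = a ++ b] cut between
    [a] and [b], where the braiding factor is 1. *)
Lemma tens_functional_comul a b :
  suffixes_gt a b -> phi a = 1 -> psi b = 1 ->
  (forall w, wsucc w a -> phi w = 0) -> (forall w, wsucc w b -> psi w = 0) ->
  lift tens_functional (comul_word q (a ++ b)) = 1 /\
  forall u, wsucc u (a ++ b) -> lift tens_functional (comul_word q u) = 0.
Proof.
move=> ab pa pb ha hb.
have expand u : lift tens_functional (comul_word q u) = \sum_(m <- masks (size u))
    braid_coef m u * (phi (mask m u) * psi (mask (map negb m) u)).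
  by rewrite comul_wordE linear_sum; apply: eq_bigr => m _; rewrite /= liftU.
have key u m : size m = size u -> u = a ++ b \/ wsucc u (a ++ b) ->
    phi (mask m u) * psi (mask (map negb m) u) != 0 ->
    u = a ++ b /\ m = nseq (size a) true ++ nseq (size b) false.
  move=> su hu; rewrite mulf_eq0 negb_or => /andP[na nb].
  have {}na : ~~ wsucc (mask m u) a by apply: contra na => /ha ->.
  have {}nb : ~~ wsucc (mask (map negb m) u) b by apply: contra nb => /hb ->.
  have szu : (size (mask m u) + size (mask (map negb m) u) = size u)%N.
    by rewrite !size_mask ?size_map // count_map -su -(count_predC id).
  move: na nb; rewrite /wsucc !negb_or -!leqNgt => /andP[sa la] /andP[sb lb].
  have su' : (size u <= size a + size b)%N.
    case: hu => [->|]; first by rewrite size_cat.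
    by rewrite /wsucc size_cat => /orP[/ltnW//|/andP[/eqP->]].
  have ea : size (mask m u) = size a.
    apply/eqP; rewrite eqn_leq sa andbT -(leq_add2r (size b)).
    by apply: leq_trans su'; rewrite -szu leq_add2l.
  have eb : size (mask (map negb m) u) = size b.
    apply/eqP; rewrite eqn_leq sb andbT -(leq_add2l (size a)).
    by apply: leq_trans su'; rewrite -szu leq_add2r.
  rewrite ea eqxx /= in la; rewrite eb eqxx /= in lb.
  have [lt|//] := shuffle_max ab su ea eb la lb.
  case: hu => [e|]; first by rewrite e lex_lt_irr in lt.
  rewrite /wsucc -szu ea eb size_cat ltnn eqxx /= => /lex_lt_trans/(_ lt).
  by rewrite lex_lt_irr.
split=> [|u hu].
  have [sm e1 e2] := mask_nseq_cat a b; set m0 := (_ ++ _) in sm e1 e2.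
  rewrite expand (bigD1_seq m0) ?uniq_masks ?mem_masks ?sm //=.
  rewrite braid_coef_unmixed e1 e2 pa pb !mulr1 big_seq_cond big1 ?addr0 // => m.
  rewrite mem_masks => /andP[/eqP su mm]; apply/eqP; apply: contraNT mm.
  by rewrite mulf_eq0 negb_or => /andP[_ /key[]//]; [left|move=> _ ->].
rewrite expand big_seq big1 // => m; rewrite mem_masks => /eqP su.
apply/eqP; rewrite mulf_eq0; apply/orP; right; apply: contrapT => /negP.
by case/key=> //; [right|move=> e; rewrite e wsucc_irr in hu].
Qed.

End CoproductFunctional.

(** Apply the coproduct followed by the tensor product of the functionals separating [a] and [b] to
    a relation [a ++ b] = f + g: the left side gives 1, f gives 0 by the order, and g gives 0
    because [J] is a coideal. *)
Lemma irreducible_cat J a b : subspace J -> coideal q J -> suffixes_gt a b ->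
  ~ reducible J a -> ~ reducible J b -> ~ reducible J (a ++ b).
Proof.
move=> sJ coJ ab na nb [f [g [sf Jg e]]].
have [phi [p0 p1 p2]] := irr_separating sJ.
have [h1 h0] := tens_functional_comul ab (p2 a na) (p2 b nb) (p1 a) (p1 b).
set F := tens_functional _ _ in h1 h0.
have Fg : lift F (comul q g) = 0.
  have [l [lJ ->]] := coJ g Jg; rewrite linear_sum big_seq big1 //= => z zl.
  rewrite tens_functionalE.
  by case: (lJ z zl) => /p0 ->; rewrite ?mul0r ?mulr0.
have comulE h : lift F (comul q h) = lift (lift F \o comul_word q) h.
  exact: (lift_linear _ (lift F)).
have Ff : lift (lift F \o comul_word q) f = 0.
  by apply: lift_eq0 => u /sf/h0.
have := congr1 (lift (lift F \o comul_word q)) e.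
rewrite linearD /= Ff add0r -(comulE g) Fg liftU /= h1 scale1r => /eqP.
by rewrite oner_eq0.
Qed.

(** * Obstructions and generators of the ideal *)

Lemma reducible_factor J p u s : two_sided_ideal J ->
  reducible J u -> reducible J (p ++ u ++ s).
Proof.
move=> [_ _ JM] [f [g [sf Jg e]]].
exists (mon k p * f * mon k s), (mon k p * g * mon k s); split.
- move=> w; have -> : mon k p * f * mon k s = lift (fun v => mon k (p ++ v ++ s)) f.
    rewrite {1}[f]monalgE mulr_sumr mulr_suml; apply: eq_bigr => v _.
    by rewrite !malgM_def !fgmulUU mul1r mulr1 catA [LHS]malgUE.
  move=> /lift_supp[v /sf vu]; rewrite mon_coef.
  by have [<- _|_] := eqVneq (p ++ v ++ s) w; [exact: wsucc_cat|rewrite eqxx].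
- by have [h _] := JM _ (mon k p) Jg; have [_] := JM _ (mon k s) h.
- by rewrite -mulrDl -mulrDr -e !monM -catA.
Qed.

Definition obstruction J w := reducible J w /\
  forall p u s, w = p ++ u ++ s -> (size u < size w)%N -> ~ reducible J u.

Lemma obstruction_factor J w : reducible J w ->
  exists p u s, w = p ++ u ++ s /\ obstruction J u.
Proof.
have [N] := ubnP (size w); elim: N w => // N IH w wN rw.
have [[p [u [s [e su ru]]]]|nex] := pselect (exists p u s,
    [/\ w = p ++ u ++ s, (size u < size w)%N & reducible J u]).
  have [|p' [u' [s' [e' ou]]]] := IH u _ ru; first exact: leq_trans su _.
  by exists (p ++ p'), u', (s' ++ s); split; rewrite // e e' !catA.
exists [::], w, [::]; rewrite cats0; split=> //; split=> // p u s e su ru.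
by case: nex; exists p, u, s.
Qed.

Lemma gen_ideal_two_sided (G : seq (talg k n)) : two_sided_ideal (gen_ideal G).
Proof.
split.
- by exists [::]; rewrite big_nil.
- move=> f g [l [lG ->]] [l' [lG' ->]]; exists (l ++ l'); rewrite big_cat.
  by split=> // z; rewrite mem_cat => /orP[/lG|/lG'].
- move=> f h [l [lG ->]]; split.
    exists [seq (h * z.1.1, z.1.2, z.2) | z <- l]; split.
      by move=> _ /mapP[z /lG zG ->].
    by rewrite big_map mulr_sumr; apply: eq_bigr => z _ /=; rewrite !mulrA.
  exists [seq (z.1.1, z.1.2, z.2 * h) | z <- l]; split.
    by move=> _ /mapP[z /lG zG ->].
  by rewrite big_map mulr_suml; apply: eq_bigr => z _ /=; rewrite !mulrA.
Qed.

Lemma gen_ideal_sub (G : seq (talg k n)) J : two_sided_ideal J ->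
  (forall g, g \in G -> J g) -> forall f, gen_ideal G f -> J f.
Proof.
move=> [J0 JD JM] GJ f [l [lG ->]]; rewrite big_seq; apply: big_ind => // z /lG/GJ zJ.
by have [h _] := JM _ z.1.1 zJ; have [_] := JM _ z.2 h.
Qed.

Lemma mem_gen_ideal (G : seq (talg k n)) g : g \in G -> gen_ideal G g.
Proof.
move=> gG; exists [:: (1, g, 1)]; rewrite big_seq1 mul1r mulr1; split=> // z.
by rewrite inE => /eqP ->.
Qed.

(** Choose for each obstruction an element of [J] with that leading word. Every word reducible for
    [J] contains an obstruction, so the chosen elements already reduce it; the remainder of an
    element of [J] lies in [J], is supported on irreducible words, and vanishes. *)
Lemma finite_obstructions_fg J (W : seq (word n)) : two_sided_ideal J ->
  (forall w, obstruction J w -> w \in W) -> finitely_generated_ideal J.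
Proof.
move=> iJ HW; have sJ := ideal_subspace iJ.
have /choice[B HB] w : exists g, J g /\ (reducible J w ->
    exists f, in_span_succ w f /\ mon k w = f + g).
  have [[f [g [sf Jg e]]]|nw] := pselect (reducible J w); last first.
    by exists 0; split=> //; case: sJ.
  by exists g; split=> // _; exists f.
pose G := map B W; have iG := gen_ideal_two_sided G.
have GJ : forall f, gen_ideal G f -> J f.
  by apply: gen_ideal_sub => // _ /mapP[w _ ->]; case: (HB w).
have red w : reducible J w -> reducible (gen_ideal G) w.
  move=> /obstruction_factor[p [u [s [-> ou]]]]; apply: reducible_factor => //.
  have [Ju /(_ ou.1)[f [sf e]]] := HB u.
  exists f, (B u); split=> //; apply: mem_gen_ideal.
  by apply/map_f/HW.
exists G => f; split=> [Jf|]; last exact: GJ.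
have sG := ideal_subspace iG.
have /choice[R HR] := reduction sG red.
have D : gen_ideal G (f - lift R f).
  rewrite sub_lift.
  by apply: subspace_lift => // z _; case: (HR z).
suff R0 : lift R f = 0 by rewrite R0 subr0 in D.
have JR : J (lift R f).
  rewrite -[lift R f](subKr f) -scaleN1r; case: sJ => _ JD JZ.
  by apply: JD => //; apply/JZ/GJ.
by apply: supported_irr0 JR _ => // u /lift_supp[z _]; have [h _ _ /h] := HR z.
Qed.

Lemma obstruction_shape J w : two_sided_ideal J -> coideal q J ->
  in_length_ge2 J -> obstruction J w ->
  (exists c v, [/\ lyndon c /\ ~ reducible J c, lyndon v /\ ~ reducible J v
     & w = c ++ v]) \/
  exists v j, (lyndon v /\ ~ reducible J v) /\ w = wpow v j.
Proof.
move=> iJ coJ J2 [rw mw]; have sJ := ideal_subspace iJ.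
(* The element of [J] witnessing reducibility has coefficient 1 at [w], so [w] has length at least
   2, as splitting a Lyndon word requires. *)
have sw : (1 < size w)%N.
  have [f [g [sf Jg e]]] := rw; apply: (J2 g Jg).
  have /eqP fw : f@_w == 0 by apply: contraT => /sf; rewrite wsucc_irr.
  by have := congr1 (mcoeff w) e; rewrite mcoeffD fw add0r mon_coef eqxx => <-; apply: oner_neq0.
have w0 : w != [::] by case: (w) sw.
have irrL p s : s != [::] -> w = p ++ s -> ~ reducible J p.
  move=> s0 e; apply: (mw [::] p s) => //.
  by rewrite e size_cat -addn1 leq_add2l lt0n size_eq0.
have irrR p s : p != [::] -> w = p ++ s -> ~ reducible J s.
  move=> p0 e; apply: (mw p s [::]); first by rewrite cats0.
  by rewrite e size_cat -add1n leq_add2r lt0n size_eq0.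
case: (lyndon_pow_or_split w0) => [[v [j [Lv e]]]|[a [b [a0 b0 e ab]]]]; last first.
  case: (irreducible_cat sJ coJ ab); [exact: irrL e|exact: irrR e|].
  by rewrite -e.
(* The exponent is [j.+1]: if it is 1, [w] is Lyndon and splits into two Lyndon words; if it is
   larger, [v] is a proper prefix of [w], hence irreducible. *)
case: j e => [|j] e.
  left; move: e; rewrite /wpow /= cats0 => e; rewrite -e in Lv.
  have [c [d [Lc Ld e']]] := lyndon_split Lv sw.
  exists c, d; split=> //; split=> //.
    by apply: irrL e'; case: Ld => /eqP.
  by apply: irrR e'; case: Lc => /eqP.
right; exists v, j.+2; split=> //; split=> //.
apply: (irrL _ (wpow v j.+1)) => //.
by case: Lv => /eqP v0 _; rewrite /wpow /=; case: (v) v0.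
Qed.

(** Of two different powers, the lower one would be a reducible proper factor of the higher one. *)
Lemma obstruction_pow_inj J v i j : v != [::] ->
  obstruction J (wpow v i) -> obstruction J (wpow v j) -> i = j.
Proof.
move=> v0.
suff h i' j' : obstruction J (wpow v i') -> obstruction J (wpow v j') -> ~~ (i' < j')%N.
  by move=> oi oj; apply/eqP; rewrite eqn_leq leqNgt (h j i) //= leqNgt (h i j).
move=> [ri _] [_ mj]; apply/negP => ij.
have e : wpow v j' = wpow v i' ++ wpow v (j' - i').
  by rewrite /wpow -flatten_cat -nseqD subnKC // ltnW.
apply: (mj [::] (wpow v i') (wpow v (j' - i'))) ri => //.
rewrite e size_cat -addn1 leq_add2l -(subnSK ij) /wpow /= size_cat.
by rewrite addn_gt0 lt0n size_eq0 v0.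
Qed.

End Nichols.

(** * Finitely many PBW letters leave finitely many obstructions *)

Theorem theorem0p3 (k : closedFieldType) (chark : [pchar k] =i pred0)
    (theta : nat) (q : 'M[k]_theta) (q_neq0 : forall i j, q i j != 0)
    (fin_roots : finite_root_system q) :
  finitely_generated_ideal (nichols_ideal q).
Proof.
have [[iJ _ J2 coJ] _] := nichols_ideal_largest q.
have [_ [l [_ lS _]]] := fin_roots.
(* [P v] is the only power of [v] that can be an obstruction; the empty word is a placeholder when
   there is none. *)
have /choice[P HP] (v : word theta) : exists w, v != [::] ->
    forall j, obstruction (nichols_ideal q) (wpow v j) -> wpow v j = w.
  have [[i oi]|no] := pselect (exists i, obstruction (nichols_ideal q) (wpow v i)).
    by exists (wpow v i) => v0 j oj; rewrite (obstruction_pow_inj v0 oi oj).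
  by exists [::] => _ j oj; case: no; exists j.
apply: (@finite_obstructions_fg _ _ _ ([seq c ++ v | c <- l, v <- l] ++ map P l)) => //.
move=> w ow; rewrite mem_cat; apply/orP.
case: (obstruction_shape iJ coJ J2 ow) => [[c [v [/lS cl /lS vl ->]]]|].
  by left; apply/allpairsP; exists (c, v).
move=> [v [j [/[dup] /lS vl [[/eqP v0 _] _] e]]]; right; apply/mapP; exists v => //.
by rewrite e in ow *; apply: HP.
Qed.
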